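(* Let $(x^{*},y^{*})$ be a saddle-point of $f$, and let $((x^k,y^k))_{k\in\mathbf N}$ be generated by the alternating proximal mapping method. Suppose $\inf_{k\in\mathbf N}\tau_k>0$ and $\inf_{k\in\mathbf N}\sigma_k>0$. Let $\xi\in(0,1)$ be such that $\xi\,\sup_{k\in\mathbf N}\tau_k\,\sup_{k\in\mathbf N}\sigma_k\,\|K\|^2<1$. Let $\eta_1,\eta_2,\eta_3,\eta_4\in\mathbf R_{++}$ be such that $$\|K\|\Big(\eta_1\xi^2+\frac1{\eta_2}\Big)\le\frac{\xi}{\sup_{i\in\mathbf N}\tau_i},\qquad \|K\|\Big(\frac1{\eta_1}+\frac1{\eta_3}\Big)\le\frac1{\sup_{i\in\mathbf N}\sigma_i},$$ $$\eta_4\ge\sup_{i\in\mathbf N}\tau_i,\qquad \frac1{\sup_{i\in\mathbf N}\sigma_i}-\xi\eta_4\|K\|^2>0.$$ Suppose that $\mu,\nu\in\mathbf R_{++}$ satisfy $$2\mu\ge\frac1{\xi\inf_{k\in\mathbf N}\tau_k}-\frac1{\sup_{k\in\mathbf N}\tau_k}+\eta_3\|K\|\sup_{k\in\mathbf N}\beta_k^2,\qquad 2\nu\ge\frac1{\xi\inf_{k\in\mathbf N}\sigma_k}-\frac1{\sup_{k\in\mathbf N}\sigma_k}+\eta_2\|K\|\sup_{k\in\mathbf N}(\xi-\alpha_k)^2.$$ Then for every $k\in\mathbf N$, $$\|x^{k+1}-x^*\|\le\xi^{k+1}\,\sup_{i\in\mathbf N}\tau_i\,\Big(\frac1{\tau_0}\|x^*-x^0\|^2+\frac1{\sigma_0}\|y^*-y^0\|^2\Big),$$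 $$\|y^{k+1}-y^*\|\le\xi^{k+1}\Big(\frac1{\sup_{i\in\mathbf N}\sigma_i}-\xi\eta_4\|K\|^2\Big)\Big(\frac1{\tau_0}\|x^*-x^0\|^2+\frac1{\sigma_0}\|y^*-y^0\|^2\Big).$$ Consequently, the sequence of iterations $((x^k,y^k))_{k\in\mathbf N}$ linearly converges to the saddle-point $(x^*,y^* )$ of $f$ with a linear rate $\xi\in(0,1)$.
   Context: $\mathbf N=\{0,1,2,\dots\}$, $\mathbf R_+=[0,\infty)$, $\mathbf R_{++}=(0,\infty)$. $\mathcal H_1,\mathcal H_2$ are Hilbert spaces; $K:\mathcal H_1\to\mathcal H_2$ is a continuous linear operator with operator norm $\|K\|$ and adjoint $K^*$. $g:\mathcal H_1\to\mathbf R\cup\{+\infty\}$ and $h:\mathcal H_2\to\mathbf R\cup\{+\infty\}$ are proper and lower semicontinuous; $\mu,\nu\in\mathbf R_{++}$; $g$ is strongly convex with modulus $\mu$, i.e. $\langle u,x-\bar x\rangle+\frac\mu2\|x-\bar x\|^2+g(\bar x)\le g(x)$ for all $\bar x\in\operatorname{dom}\partial g$, $u\in\partial g(\bar x)$, $x\in\mathcal H_1$; and $h$ is strongly convex with modulus $\nu$ (same inequality with $h,\nu,\mathcal H_2$). Define $f(x,y)=\langle Kx,y\rangle+g(x)-h(y)$ on $\mathcal H_1\times\mathcal H_2$. A saddle-point of $f$ is $(x^*,y^* )$ with $f(x^*,y)\le f(x^*,y^* )\le f(x,y^* )$ for all $x\in\mathcal H_1,y\in\mathcal H_2$; one is assumed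 to exist. Alternating proximal mapping method: given sequences $(\tau_k)_{k\in\mathbf N\cup\{-1\}}$, $(\sigma_k)_{k\in\mathbf N\cup\{-1\}}$ in $\mathbf R_{++}$ and $(\alpha_k)_{k\in\mathbf N\cup\{-1\}}$, $(\beta_k)_{k\in\mathbf N\cup\{-1\}}$ in $\mathbf R_+$, and $(x^0,y^0)\in\mathcal H_1\times\mathcal H_2$, set $x^{-1}=x^0$, $y^{-1}=y^0$, $\bar x^0=x^0$, $\bar y^0=y^0$ and for every $k\in\mathbf N$: $y^{k+1}=\operatorname{Prox}_{\sigma_kh}(\sigma_kK\bar x^k+y^k)$; $\bar y^{k+1}=y^{k+1}+\beta_k(y^{k+1}-y^k)$; $x^{k+1}=\operatorname{Prox}_{\tau_kg}(-\tau_kK^*\bar y^{k+1}+x^k)$; $\bar x^{k+1}=x^{k+1}+\alpha_k(x^{k+1}-x^k)$. Here $\operatorname{Prox}_\varphi(z)=\operatorname{argmin}_w(\varphi(w)+\frac12\|z-w\|^2)$.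
   Formalization: The printed bounds are false; here they bound the squares ‖x^{k+1}−x*‖² and ‖y^{k+1}−y*‖², the factor (1/sup σ − ξη₄‖K‖²) in the y-bound is inverted, and the linear rate ξ is that of the squared distance; strong convexity explicitly includes convexity. *)

(* Defs.v *)
From HB Require Import structures.
From mathcomp Require Import all_boot all_order all_algebra.
From mathcomp Require Import all_classical all_reals all_analysis.

Set Implicit Arguments.
Unset Strict Implicit.
Unset Printing Implicit Defensive.

Import Order.TTheory GRing.Theory Num.Theory.
Import numFieldNormedType.Exports.

Local Open Scope classical_set_scope.
Local Open Scope ring_scope.

(* A real Hilbert space is a complete normed module H together with a form
   d : {dot H for idfun} (symmetric, bilinear, positive definite) that induces
   the norm of H. *)
Definition induces_norm (R : realType) (H : completeNormedModType R)
    (d : {dot H for idfun}) : Prop :=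
  forall x : H, `|x| ^+ 2 = d x x.

(* The set below is bounded when K is continuous, so that the real-valued sup
   is the actual supremum. *)
Definition opnorm (R : realType) (H1 H2 : completeNormedModType R)
    (K : H1 -> H2) : R :=
  sup [set `|K x| | x in [set x : H1 | `|x| <= 1]].

(* This determines Ks uniquely, since d1 is definite. *)
Definition is_adjoint (R : realType) (H1 H2 : completeNormedModType R)
    (d1 : {dot H1 for idfun}) (d2 : {dot H2 for idfun})
    (K : H1 -> H2) (Ks : H2 -> H1) : Prop :=
  forall (x : H1) (y : H2), d2 (K x) y = d1 x (Ks y).

Section one_space.
Local Open Scope ereal_scope.
Context {R : realType} {H : completeNormedModType R}.
Variable d : {dot H for idfun}.
Implicit Types (g phi : H -> \bar R) (x z u : H).

Definition proper_efun g : Prop :=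
  (forall x, g x != -oo) /\ exists x, g x < +oo.

Definition convex_efun g : Prop :=
  forall x z (t : R), (0 <= t <= 1)%R ->
    g (t *: x + (1 - t) *: z)%R <= t%:E * g x + (1 - t)%:E * g z.

Definition subdifferential g x : set H :=
  [set u | forall z, (d u (z - x)%R)%:E + g x <= g z].

(* For a proper, lower semicontinuous and convex g, the inequality over
   dom (subdifferential g) characterizes strong convexity of modulus m.
   Convexity is a separate clause: for a nonconvex g, the inequality constrains
   only the points at which g has a global subgradient. *)
Definition strongly_convex (m : R) g : Prop :=
  convex_efun g /\
  forall x u, subdifferential g x u -> forall z,
    (d u (z - x)%R)%:E + (m / 2 * `|z - x| ^+ 2)%:E + g x <= g z.

(* The set of minimizers: a singleton when phi is proper, lower semicontinuous
   and convex. *)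
Definition Prox phi z : set H :=
  [set p | forall w, phi p + (2^-1 * `|z - p| ^+ 2)%:E
                       <= phi w + (2^-1 * `|z - w| ^+ 2)%:E].

End one_space.

Section two_spaces.
Local Open Scope ereal_scope.
Context {R : realType} {H1 H2 : completeNormedModType R}.

(* When g and h are proper, a saddle point (xs, ys) in the sense below satisfies
   g xs < +oo and h ys < +oo, whatever value +oo - +oo is given (here -oo). *)
Definition saddle_fun (d2 : {dot H2 for idfun}) (K : H1 -> H2)
    (g : H1 -> \bar R) (h : H2 -> \bar R) (x : H1) (y : H2) : \bar R :=
  (d2 (K x) y)%:E + g x - h y.

Definition saddle_point (f : H1 -> H2 -> \bar R) (xs : H1) (ys : H2) : Prop :=
  forall x y, f xs y <= f xs ys <= f x ys.

(* xb and yb are the extrapolated sequences. *)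
Definition alternating_proximal_mapping (K : H1 -> H2) (Ks : H2 -> H1)
    (g : H1 -> \bar R) (h : H2 -> \bar R) (tau sigma alpha beta : nat -> R)
    (x xb : nat -> H1) (y yb : nat -> H2) : Prop :=
  [/\ xb 0%N = x 0%N, yb 0%N = y 0%N &
      forall k : nat,
      [/\ Prox (fun w => (sigma k)%:E * h w)
               (sigma k *: K (xb k) + y k)%R (y k.+1),
          yb k.+1 = (y k.+1 + beta k *: (y k.+1 - y k))%R,
          Prox (fun w => (tau k)%:E * g w)
               (- (tau k *: Ks (yb k.+1)) + x k)%R (x k.+1) &
          xb k.+1 = (x k.+1 + alpha k *: (x k.+1 - x k))%R ]].

(* The rate xi is that of the squared distance in the product H1 * H2. *)
Definition converges_linearly (x : nat -> H1) (y : nat -> H2)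
    (xs : H1) (ys : H2) (xi : R) : Prop :=
  [/\ x n @[n --> \oo] --> xs, y n @[n --> \oo] --> ys &
      exists C : R, forall k : nat,
        (`|x k - xs| ^+ 2 + `|y k - ys| ^+ 2 <= C * xi ^+ k)%R].

End two_spaces.

(* Extended-real supremum and infimum over nat; recall that in \bar R one has
   (+oo)^-1 = 0 and 0 * +oo = 0. *)
Definition seq_sup (R : realType) (u : nat -> R) : \bar R :=
  ereal_sup (range (fun k => (u k)%:E)).

Definition seq_inf (R : realType) (u : nat -> R) : \bar R :=
  ereal_inf (range (fun k => (u k)%:E)).

(* Main.v *)
(* Each proximal step turns into a subgradient inclusion; paired with the optimality
   inclusions at the saddle point and strong monotonicity, the two steps bound
   |x^{k+1} - x*|^2 and |y^{k+1} - y*|^2 up to the coupling terms <K _, _>. Young's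
   inequality with weights eta1, eta2, eta3 absorbs these, and the energy
     V_k = |x^k - x*|^2 / tau_k + |y^k - y*|^2 / sigma_k
           + xi / sup tau * |x^k - x^{k-1}|^2
           + 2 xi <K (x^k - x^{k-1}), y^k - y*>
   satisfies V_{k+1} <= xi V_k. Young's inequality with weight eta4 bounds V_k
   below by a positive combination of the two squared distances. *)

Require Import Defs.
From HB Require Import structures.
From mathcomp Require Import all_boot all_order all_algebra.
From mathcomp Require Import all_classical all_reals all_analysis.
From mathcomp Require Import ring lra.

Set Implicit Arguments.
Unset Strict Implicit.
Unset Printing Implicit Defensive.

Import Order.TTheory GRing.Theory Num.Theory.
Import numFieldNormedType.Exports.
Local Open Scope classical_set_scope.
Local Open Scope ring_scope.
Local Open Scope ereal_scope.

(** * Inner-product algebra and the Cauchy-Schwarz inequality *)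

Section inner_product.
Local Open Scope ring_scope.
Context {R : realType} {H : completeNormedModType R} {d : {dot H for idfun}}.
Implicit Types (u v w : H) (a : R).

Lemma dotC u v : d u v = d v u.
Proof. by rewrite hermC expr0 mul1r. Qed.

Lemma dotBl u v w : d (u - v) w = d u w - d v w.
Proof. exact: linearBl. Qed.

Lemma dotBr u v w : d u (v - w) = d u v - d u w.
Proof. exact: linearBr. Qed.

Lemma dotDl u v w : d (u + v) w = d u w + d v w.
Proof. exact: linearDl. Qed.

Lemma dotDr u v w : d u (v + w) = d u v + d u w.
Proof. exact: linearDr. Qed.

Lemma dotNl u v : d (- u) v = - d u v.
Proof. exact: linearNl. Qed.

Lemma dotNr u v : d u (- v) = - d u v.
Proof. exact: linearNr. Qed.

Lemma dotZl a u v : d (a *: u) v = a * d u v.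
Proof. exact: linearZl_LR. Qed.

Lemma dotZr a u v : d u (a *: v) = a * d u v.
Proof. exact: linearZr_LR. Qed.

Lemma dot0l u : d 0 u = 0.
Proof. exact: linear0l. Qed.

Hypothesis hd : induces_norm d.

Lemma sqr_normB u v : `|u - v| ^+ 2 = `|u| ^+ 2 - 2 * d u v + `|v| ^+ 2.
Proof. rewrite !hd dotBl !dotBr (dotC v u); ring. Qed.

Lemma dot_le_norm u v : `|d u v| <= `|u| * `|v|.
Proof.
have CS w : d w v <= `|w| * `|v|.
  have [->|w0] := eqVneq w 0; first by rewrite dot0l normr0 mul0r.
  have [->|v0] := eqVneq v 0; first by rewrite dotC dot0l normr0 mulr0.
  have wv : 0 < `|w| * `|v| by rewrite mulr_gt0 ?normr_gt0.
  have := sqr_ge0 `| `|v| *: w - `|w| *: v|.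
  rewrite sqr_normB !normrZ !normr_id dotZl dotZr => le0.
  by rewrite -(ler_pM2l wv); nra.
by rewrite ler_norml lerNl -dotNl CS -(normrN u) CS.
Qed.

End inner_product.

(** * Proximal points, subgradients and strong monotonicity *)

Section convex_functions.
Context {R : realType} {H : completeNormedModType R} {d : {dot H for idfun}}.
Hypothesis hd : induces_norm d.
Implicit Types (g : H -> \bar R) (p q u v z : H).

Lemma prox_lty g (t : R) z p : proper_efun g -> (0 < t)%R ->
  Prox (fun w => t%:E * g w) z p -> g p < +oo.
Proof.
move=> [gNy [w gw]] t0 /(_ w) /=.
have [r gwE] : exists r, g w = r%:E.
  by move: (gNy w) gw; case: (g w) => // r; exists r.
rewrite gwE ltey; case: (g p) => [s| |] //.
by rewrite gt0_muley ?lte_fin// addye.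
Qed.

(** Minimality of [p] is tested at the points [s w + (1 - s) p] of the segment towards [w]. By
    convexity every term that remains carries a factor [s]; after dividing by it, letting [s] tend
    to 0 removes the quadratic term. *)
Lemma prox_subdifferential g (t : R) z p :
  proper_efun g -> convex_efun g -> (0 < t)%R ->
  Prox (fun w => t%:E * g w) z p ->
  subdifferential d g p (t^-1 *: (z - p))%R.
Proof.
move=> gp gc t0 pp w /=.
have := prox_lty gp t0 pp; have := gp.1 w; have := gp.1 p.
case gpE: (g p) => [a| |] // _; case gwE: (g w) => [b| |] //= _ _; last first.
  by rewrite leey.
rewrite -EFinD lee_fin.
have key (s : R) : (0 < s <= 1)%R ->
    (t * a + d (z - p) (w - p) <= t * b + s / 2 * `|w - p| ^+ 2)%R.
  move=> /andP[s0 s1].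
  have zE : (z - (s *: w + (1 - s) *: p) = (z - p) - s *: (w - p))%R.
    by rewrite scalerBl scale1r scalerBr addrCA opprD addrA.
  have := pp (s *: w + (1 - s) *: p)%R.
  have := gc w p s; rewrite (ltW s0) s1 => /(_ isT).
  rewrite gpE gwE -!EFinM -!EFinD.
  have := gp.1 (s *: w + (1 - s) *: p)%R.
  case: (g _) => [c| |] // _; rewrite lee_fin => cle.
  rewrite -!EFinM -!EFinD lee_fin zE (sqr_normB hd (z - p)%R) dotZr.
  rewrite normrZ (gtr0_norm s0) exprMn => le1.
  have : (s * (t * a + d (z - p) (w - p)) <=
          s * (t * b + s / 2 * `|w - p| ^+ 2))%R.
    have := ler_wpM2l (ltW t0) cle; nra.
  by rewrite ler_pM2l.
(* For a tolerance [e], the choice [s = 2 e / n2] makes the quadratic term equal to [e]; when this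
   exceeds 1, [s = 1] already suffices. *)
have lim0 : (t * a + d (z - p) (w - p) <= t * b)%R.
  apply/ler_addgt0Pr => e e0.
  set n2 := (`|w - p| ^+ 2)%R in key *.
  have n20 : (0 <= n2)%R by exact: sqr_ge0.
  have [le2|lt2] := leP n2 (2 * e)%R.
    by have := key 1%R; rewrite ltr01 lexx => /(_ isT); lra.
  have n2gt : (0 < n2)%R by apply: lt_trans lt2; rewrite mulr_gt0.
  have := key (2 * e / n2)%R.
  have -> : (0 < 2 * e / n2 <= 1)%R.
    by rewrite ler_pdivrMr// mul1r (ltW lt2) divr_gt0// mulr_gt0.
  move=> /(_ isT).
  suff -> : (2 * e / n2 / 2 * n2 = e)%R by [].
  by field; lra.
rewrite dotZl -(ler_pM2l t0) mulrDr mulrA mulfV ?gt_eqF//.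
lra.
Qed.

(** The strong convexity inequalities at [p] and at [q] are added: the finite values of [g] cancel
    and the two halves [m / 2] make [m]. *)
Lemma strongly_convex_monotone (m a b : R) g p q u v :
  strongly_convex d m g -> g p = a%:E -> g q = b%:E ->
  subdifferential d g p u -> subdifferential d g q v ->
  (m * `|p - q| ^+ 2 <= d (u - v) (p - q))%R.
Proof.
move=> [_ gsc] gpE gqE /gsc/(_ q) + /gsc/(_ p).
rewrite gpE gqE -!EFinD !lee_fin (distrC q p) -(opprB p q) dotNr dotBl.
by move=> ? ?; lra.
Qed.

End convex_functions.

(** * The operator norm of a continuous linear map, and Young's inequality *)

Section operator_norm.
Local Open Scope ring_scope.
Context {R : realType} {H1 H2 : completeNormedModType R}.
Variable K : {linear H1 -> H2}.

Hypothesis K_cont : continuous K.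

Lemma has_ubound_opnorm :
  has_ubound [set `|K x| | x in [set x : H1 | `|x| <= 1]].
Proof.
have /bounded_funP/(_ 1) [M KM] := (linear_bounded_continuous K).2 K_cont.
by exists M => _ [w w1 <-]; exact: KM.
Qed.

Lemma opnorm_ge0 : 0 <= opnorm K.
Proof.
apply: (ub_le_sup has_ubound_opnorm).
by exists 0; rewrite /= ?linear0 normr0.
Qed.

Lemma le_opnorm x : `|K x| <= opnorm K * `|x|.
Proof.
have [->|x0] := eqVneq x 0; first by rewrite raddf0 !normr0 mulr0.
have nx : 0 < `|x| by rewrite normr_gt0.
rewrite -ler_pdivrMr// mulrC.
have -> : `|x|^-1 * `|K x| = `|K (`|x|^-1 *: x)|.
  by rewrite linearZ /= normrZ ger0_norm// invr_ge0 ltW.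
apply: (ub_le_sup has_ubound_opnorm).
by exists (`|x|^-1 *: x) => //=; rewrite normrZ ger0_norm ?invr_ge0// mulVf ?gt_eqF.
Qed.

End operator_norm.

Lemma young_sqr (R : realType) (a b eta : R) : (0 < eta)%R ->
  (2 * (a * b) <= eta * a ^+ 2 + eta^-1 * b ^+ 2)%R.
Proof.
move=> eta0; rewrite -subr_ge0.
have -> : (eta * a ^+ 2 + eta^-1 * b ^+ 2 - 2 * (a * b)
  = eta * (a - eta^-1 * b) ^+ 2)%R by field; rewrite gt_eqF.
by rewrite mulr_ge0 ?sqr_ge0 ?ltW.
Qed.

(** * The estimate for one proximal step *)

Section prox_step.
Local Open Scope ring_scope.
Context {R : realType} {H : completeNormedModType R} {d : {dot H for idfun}}.
Hypothesis hd : induces_norm d.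

(** The subgradient at [p] is [c + (z - p) / t]. Strong monotonicity against [v] at [q] leaves twice
    the product of [z - p] and [p - q], which the three-point identity writes with squared
    distances. Both half-steps of the algorithm are instances, [c] being the coupling term. *)
Lemma prox_step (m t b : R) g (z c p q v : H) :
  proper_efun g -> strongly_convex d m g -> 0 < t ->
  Prox (fun w => (t%:E * g w)%E) (t *: c + z) p ->
  g q = b%:E -> subdifferential d g q v ->
  2 * m * `|p - q| ^+ 2 <=
    t^-1 * (`|z - q| ^+ 2 - `|p - q| ^+ 2 - `|p - z| ^+ 2)
    + 2 * d (c - v) (p - q).
Proof.
move=> gp gsc t0 pp gq vq.
have [a gpE] : exists a, g p = a%:E.
  by have := prox_lty gp t0 pp; have := gp.1 p; case: (g p) => // a _ _; exists a.
have := strongly_convex_monotone gsc gpE gq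
  (prox_subdifferential hd gp gsc.1 t0 pp) vq.
have -> : t^-1 *: (t *: c + z - p) - v = (c - v) + t^-1 *: (z - p).
  by rewrite -addrA scalerDr scalerA mulVf ?gt_eqF// scale1r addrAC.
rewrite dotDl dotZl => le1.
have -> : `|p - z| ^+ 2 = `|z - q| ^+ 2 - 2 * d (z - q) (p - q) + `|p - q| ^+ 2.
  by rewrite -(sqr_normB hd) distrC; congr (`|_| ^+ 2); rewrite opprB addrA subrK.
have zpE : d (z - p) (p - q) = d (z - q) (p - q) - `|p - q| ^+ 2.
  by rewrite hd -dotBl opprB addrA subrK.
move: le1; rewrite zpE; nra.
Qed.

End prox_step.

(** * Optimality at a saddle point, and descent of the energy *)

Section two_spaces.
Context {R : realType} {H1 H2 : completeNormedModType R}.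
Context {d1 : {dot H1 for idfun}} {d2 : {dot H2 for idfun}}.
Variables (K : {linear H1 -> H2}) (Ks : H2 -> H1).

(** With one variable frozen at the saddle point, each half of the saddle inequality is a
    subgradient inequality in the other variable, once the values at the saddle point are known to
    be finite. *)
Lemma saddle_point_subdifferential (g : H1 -> \bar R) (h : H2 -> \bar R) xs ys :
  is_adjoint d1 d2 K Ks -> proper_efun g -> proper_efun h ->
  saddle_point (saddle_fun d2 K g h) xs ys ->
  [/\ g xs \is a fin_num, h ys \is a fin_num,
      subdifferential d1 g xs (- Ks ys)%R & subdifferential d2 h ys (K xs)].
Proof.
move=> hKs [gNy [x0 gx0]] [hNy [y0 hy0]] sp.
(* [h ys] comes first: as +oo - +oo is -oo, an infinite [h ys] makes the saddle value -oo whatever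
   [g xs] is, below the value at [y0]. With [h ys] finite, an infinite [g xs] would make it +oo,
   above the value at [x0]. *)
have hys : h ys \is a fin_num.
  rewrite fin_numE hNy; apply/eqP => hy.
  have /andP[+ _] := sp x0 y0; rewrite /saddle_fun hy.
  by move: (gNy xs) (hNy y0) hy0; case: (g xs) => [?| |]; case: (h y0) => [?| |] //=.
have gxs : g xs \is a fin_num.
  rewrite fin_numE gNy; apply/eqP => gx.
  have /andP[_] := sp x0 y0; rewrite /saddle_fun gx -(fineK hys).
  by move: (gNy x0) gx0; case: (g x0) => [?| |] //=.
split => //= [x|y].
- have /andP[_] := sp x ys; rewrite /saddle_fun -(fineK hys) -(fineK gxs).
  move: (gNy x); case: (g x) => [r| |] // _; last by move=> _; rewrite leey.
  rewrite -!EFinD !lee_fin dotNl dotBr !(dotC (Ks ys)) -!hKs; lra.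
- have /andP[+ _] := sp xs y; rewrite /saddle_fun -(fineK hys) -(fineK gxs).
  move: (hNy y); case: (h y) => [r| |] // _; last by move=> _; rewrite leey.
  rewrite -!EFinN -!EFinD !lee_fin dotBr; lra.
Qed.

Local Open Scope ring_scope.
Hypothesis hd2 : induces_norm d2.
Hypothesis K_cont : continuous K.

Lemma dot_opnorm_le (u : H1) (v : H2) :
  d2 (K u) v <= opnorm K * (`|u| * `|v|).
Proof.
rewrite (le_trans (ler_norm _))// mulrA (le_trans (dot_le_norm hd2 _ _))//.
by rewrite ler_wpM2r// le_opnorm.
Qed.

Lemma dot_opnorm_young (eta : R) (u : H1) (v : H2) : 0 < eta ->
  2 * d2 (K u) v <= opnorm K * (eta * `|u| ^+ 2 + eta^-1 * `|v| ^+ 2).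
Proof.
move=> eta0; apply: (@le_trans _ _ (opnorm K * (2 * (`|u| * `|v|)))).
  by rewrite mulrCA ler_pM2l// dot_opnorm_le.
by rewrite ler_wpM2l ?opnorm_ge0// young_sqr.
Qed.

(* [alpha] is arbitrary when [u = 0], which covers the first iteration,
   where the extrapolated point is the starting point itself. *)
Lemma energy_descent (tau sigma tau' sigma' T S mu nu alpha beta xi : R)
  (eta1 eta2 eta3 : R) (u X0 X : H1) (Y0 Y : H2) :
  0 < xi -> 0 < eta1 -> 0 < eta2 -> 0 < eta3 ->
  T^-1 <= tau^-1 -> S^-1 <= sigma^-1 ->
  opnorm K * (eta1 * xi ^+ 2 + eta2^-1) <= xi / T ->
  opnorm K * (eta1^-1 + eta3^-1) <= S^-1 ->
  (xi * tau')^-1 - T^-1 + eta3 * opnorm K * beta ^+ 2 <= 2 * mu ->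
  (xi * sigma')^-1 - S^-1 + eta2 * opnorm K * (xi - alpha) ^+ 2 <= 2 * nu ->
  2 * mu * `|X| ^+ 2 <=
    tau^-1 * (`|X0| ^+ 2 - `|X| ^+ 2 - `|X - X0| ^+ 2)
    - 2 * d2 (K X) (Y + beta *: (Y - Y0)) ->
  2 * nu * `|Y| ^+ 2 <=
    sigma^-1 * (`|Y0| ^+ 2 - `|Y| ^+ 2 - `|Y - Y0| ^+ 2)
    + 2 * d2 (K (X0 + alpha *: u)) Y ->
  tau'^-1 * `|X| ^+ 2 + sigma'^-1 * `|Y| ^+ 2
    + xi / T * `|X - X0| ^+ 2 + 2 * xi * d2 (K (X - X0)) Y <=
  xi * (tau^-1 * `|X0| ^+ 2 + sigma^-1 * `|Y0| ^+ 2
    + xi / T * `|u| ^+ 2 + 2 * xi * d2 (K u) Y0).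
Proof.
move=> xi0 e1 e2 e3 tauT sigmaS e12 e13 hmu hnu stepx stepy.
have KD : K (X - X0) = K X - K X0 by rewrite raddfB.
have Ku : K (X0 + alpha *: u) = K X0 + alpha *: K u by rewrite raddfD /= linearZ.
have KZ (a : R) w : K (a *: w) = a *: K w by rewrite linearZ.
have sqrZ (H : completeNormedModType R) (a : R) (w : H) :
  `|a *: w| ^+ 2 = a ^+ 2 * `|w| ^+ 2 by rewrite normrZ exprMn real_normK ?num_real.
(* The coupling [alpha <K u, Y>] splits as [xi <K u, Y0> + xi <K u, Y - Y0> + (alpha - xi) <K u,
   Y>]. The first term belongs to the old energy; [y1] and [y2] bound the other two, and [y3] bounds
   the term produced by [beta]. *)
have y1 := dot_opnorm_young (xi *: u) (Y - Y0) e1.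
have y2 := dot_opnorm_young u ((alpha - xi) *: Y) (etrans (invr_gt0 _) e2).
have y3 := dot_opnorm_young (- beta *: X) (Y - Y0) e3.
move: y1 y2 y3 stepx stepy.
rewrite KD Ku !KZ invrK !sqrZ !(dotDl, dotDr, dotZl, dotZr, dotNl, dotNr).
have := sqr_ge0 `|X|; have := sqr_ge0 `|Y|; have := sqr_ge0 `|u|.
have := sqr_ge0 `|X - X0|; have := sqr_ge0 `|Y - Y0|.
move=> E_ge0 D_ge0 u_ge0 Y_ge0 X_ge0 y1 y2 y3 stepx stepy.
have m12 := ler_wpM2r u_ge0 e12.
have m13 := ler_wpM2r E_ge0 (le_trans e13 sigmaS).
have mX := ler_wpM2r X_ge0 hmu.
have mY := ler_wpM2r Y_ge0 hnu.
have mX' := ler_wpM2r X_ge0 tauT.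
have mY' := ler_wpM2r Y_ge0 sigmaS.
have mD := ler_wpM2r D_ge0 tauT.
(* This is the goal divided by [xi]. The terms in [|u|^2] are covered by [m12], those in
   [|Y - Y0|^2] by [m13], and those in [|X|^2] and [|Y|^2] by the strong convexity moduli. *)
have le1 : (xi * tau')^-1 * `|X| ^+ 2 + (xi * sigma')^-1 * `|Y| ^+ 2
    + T^-1 * `|X - X0| ^+ 2 + 2 * (d2 (K X) Y - d2 (K X0) Y) <=
  tau^-1 * `|X0| ^+ 2 + sigma^-1 * `|Y0| ^+ 2
    + xi / T * `|u| ^+ 2 + 2 * xi * d2 (K u) Y0 by lra.
apply: le_trans (ler_wpM2l (ltW xi0) le1); rewrite !invfM.
move: tau'^-1 sigma'^-1 T^-1 => a b c.
by rewrite le_eqVlt; apply/orP; left; apply/eqP; field; rewrite gt_eqF.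
Qed.

End two_spaces.

(** * Geometric convergence, and passage from extended-real bounds to real ones *)

Lemma cvg_sqr_geometric (R : realType) (V : normedModType R) (u : nat -> V)
    (l : V) (C q : R) : (`|q| < 1)%R ->
  (forall n, (`|u n - l| ^+ 2 <= C * q ^+ n)%R) -> u n @[n --> \oo] --> l.
Proof.
move=> q1 hu; apply/cvgrPdist_lt => e e0.
have := cvg_geometric C q1 => /cvgr_lt/(_ (e ^+ 2)%R).
rewrite exprn_gt0// => /(_ isT); apply: filterS => n /= hn.
rewrite -(@ltr_pXn2r _ 2) ?nnegrE ?(ltW e0)// distrC.
exact: le_lt_trans hn.
Qed.

Lemma le_seq_sup (R : realType) (u : nat -> R) k : (u k)%:E <= seq_sup u.
Proof. by apply: ereal_sup_ubound; exists k. Qed.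

Lemma seq_inf_le (R : realType) (u : nat -> R) k : seq_inf u <= (u k)%:E.
Proof. by apply: ereal_inf_lbound; exists k. Qed.

Lemma seq_sup_gt0_fin (R : realType) (u : nat -> R) :
  (forall k, (0 < u k)%R) -> seq_sup u < +oo ->
  exists2 M : R, seq_sup u = M%:E & forall k, (0 < u k <= M)%R.
Proof.
move=> u0; have := le_seq_sup u; case: (seq_sup u) => [M| |] // hu _.
  by exists M => // k; rewrite u0 -lee_fin hu.
by have := hu 0%N.
Qed.

Lemma seq_inf_gt0_fin (R : realType) (u : nat -> R) :
  0 < seq_inf u ->
  exists2 m : R, seq_inf u = m%:E & (0 < m)%R /\ forall k, (m <= u k)%R.
Proof.
have := seq_inf_le u; case: (seq_inf u) => [m| |] // hu m0; last first.
  by have := hu 0%N.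
by exists m => //; split=> // k; rewrite -lee_fin.
Qed.

(** The indices [i] and [k] are independent because the infimum controls [u] and the supremum
    controls [b] separately; the descent pairs the next step size with an earlier extrapolation
    parameter. *)
Lemma strong_convexity_modulus_le (R : realType) (u b : nat -> R)
    (xi M m c mod : R) :
  (0 < xi)%R -> (0 < m)%R -> (0 < M)%R -> (0 <= c)%R ->
  (forall k, (m <= u k)%R) ->
  (xi%:E * m%:E)^-1 - M%:E^-1 + c%:E * seq_sup (fun k => (b k ^+ 2)%R)
    <= mod%:E ->
  forall i k, ((xi * u i)^-1 - M^-1 + c * b k ^+ 2 <= mod)%R.
Proof.
move=> xi0 m0 M0 c0 mu hmod i k; rewrite -lee_fin; apply: le_trans hmod.
rewrite -EFinM !inver !gt_eqF ?mulr_gt0//.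
rewrite EFinD EFinB; apply: leeD.
  apply: leeB => //; rewrite lee_fin lef_pV2 ?posrE ?mulr_gt0 ?ler_pM2l//.
  exact: lt_le_trans (mu i).
by rewrite EFinM lee_wpmul2l ?lee_fin//; exact: (le_seq_sup (fun k => (b k ^+ 2)%R)).
Qed.

Theorem theorem3p1 (R : realType) (H1 H2 : completeNormedModType R)
  (d1 : {dot H1 for idfun}) (d2 : {dot H2 for idfun})
  (hd1 : induces_norm d1) (hd2 : induces_norm d2)
  (K : {linear H1 -> H2}) (Ks : H2 -> H1)
  (K_cont : continuous K) (hKs : is_adjoint d1 d2 K Ks)
  (g : H1 -> \bar R) (h : H2 -> \bar R) (mu nu : R)
  (g_proper : proper_efun g) (g_lsc : lower_semicontinuous g)
  (h_proper : proper_efun h) (h_lsc : lower_semicontinuous h)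
  (mu_gt0 : (0 < mu)%R) (nu_gt0 : (0 < nu)%R)
  (g_sc : strongly_convex d1 mu g) (h_sc : strongly_convex d2 nu h)
  (tau sigma alpha beta : nat -> R)
  (tau_gt0 : forall k, (0 < tau k)%R) (sigma_gt0 : forall k, (0 < sigma k)%R)
  (alpha_ge0 : forall k, (0 <= alpha k)%R) (beta_ge0 : forall k, (0 <= beta k)%R)
  (x xb : nat -> H1) (y yb : nat -> H2)
  (algo : alternating_proximal_mapping K Ks g h tau sigma alpha beta x xb y yb)
  (xs : H1) (ys : H2) (saddle : saddle_point (saddle_fun d2 K g h) xs ys)
  (inf_tau_gt0 : 0 < seq_inf tau) (inf_sigma_gt0 : 0 < seq_inf sigma)
  (xi : R) (xi_gt0 : (0 < xi)%R) (xi_lt1 : (xi < 1)%R)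
  (xi_K : xi%:E * seq_sup tau * seq_sup sigma * (opnorm K ^+ 2)%:E < 1)
  (eta1 eta2 eta3 eta4 : R)
  (eta1_gt0 : (0 < eta1)%R) (eta2_gt0 : (0 < eta2)%R)
  (eta3_gt0 : (0 < eta3)%R) (eta4_gt0 : (0 < eta4)%R)
  (eta12 : (opnorm K * (eta1 * xi ^+ 2 + eta2^-1))%:E <= xi%:E / seq_sup tau)
  (eta13 : (opnorm K * (eta1^-1 + eta3^-1))%:E <= (seq_sup sigma)^-1)
  (eta4_tau : seq_sup tau <= eta4%:E)
  (eta4_sigma : 0 < (seq_sup sigma)^-1 - (xi * eta4 * opnorm K ^+ 2)%:E)
  (mu_ge : (xi%:E * seq_inf tau)^-1 - (seq_sup tau)^-1
             + (eta3 * opnorm K)%:E * seq_sup (fun k => (beta k ^+ 2)%R)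
           <= (2 * mu)%:E)
  (nu_ge : (xi%:E * seq_inf sigma)^-1 - (seq_sup sigma)^-1
             + (eta2 * opnorm K)%:E * seq_sup (fun k => ((xi - alpha k) ^+ 2)%R)
           <= (2 * nu)%:E) :
  (forall k : nat,
     (`|x k.+1 - xs| ^+ 2)%:E <=
       (xi ^+ k.+1)%:E * seq_sup tau *
         ((tau 0%N)^-1 * `|xs - x 0%N| ^+ 2
            + (sigma 0%N)^-1 * `|ys - y 0%N| ^+ 2)%:E
     /\
     (`|y k.+1 - ys| ^+ 2)%:E <=
       (xi ^+ k.+1)%:E
         * ((seq_sup sigma)^-1 - (xi * eta4 * opnorm K ^+ 2)%:E)^-1 *
         ((tau 0%N)^-1 * `|xs - x 0%N| ^+ 2
            + (sigma 0%N)^-1 * `|ys - y 0%N| ^+ 2)%:E)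
  /\ converges_linearly x y xs ys xi.
Proof.
set L := opnorm K in xi_K eta12 eta13 eta4_sigma mu_ge nu_ge *.
have L0 : (0 <= L)%R by exact: opnorm_ge0.
have [T TE tauT] := seq_sup_gt0_fin tau_gt0 (le_lt_trans eta4_tau (ltry _)).
(* An infinite supremum would have inverse 0, and [eta4_sigma] would make a nonpositive number
   positive. *)
have sup_sigma : seq_sup sigma < +oo.
  rewrite ltey; apply/eqP => sE; move: eta4_sigma.
  rewrite sE invey sub0e -EFinN lte_fin oppr_gt0 ltNge.
  by move=> /negP; apply; rewrite mulr_ge0 ?sqr_ge0// mulr_ge0 ?ltW.
have [S SE sigmaS] := seq_sup_gt0_fin sigma_gt0 sup_sigma.
have [t tE [t0 ttau]] := seq_inf_gt0_fin inf_tau_gt0.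
have [s sE [s0 ssigma]] := seq_inf_gt0_fin inf_sigma_gt0.
have T0 : (0 < T)%R by have /andP[? ?] := tauT 0%N; exact: (@lt_le_trans _ _ (tau 0%N)).
have S0 : (0 < S)%R by have /andP[? ?] := sigmaS 0%N; exact: (@lt_le_trans _ _ (sigma 0%N)).
rewrite TE SE tE sE in eta12 eta13 eta4_tau eta4_sigma mu_ge nu_ge *.
have {}mu_ge := strong_convexity_modulus_le xi_gt0 t0 T0
  (mulr_ge0 (ltW eta3_gt0) L0) ttau mu_ge.
have {}nu_ge := strong_convexity_modulus_le xi_gt0 s0 S0
  (mulr_ge0 (ltW eta2_gt0) L0) ssigma nu_ge.
move: eta12 eta13 eta4_sigma.
rewrite !inver !gt_eqF// -EFinM -EFinB !lee_fin lte_fin inver.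
move=> eta12 eta13 eta4_sigma.
rewrite gt_eqF//.
have [gxs hys gsub hsub] := saddle_point_subdifferential hKs g_proper h_proper saddle.
have [xb0 yb0 iter] := algo.
(* At [k = 0] the predecessor is again 0, so the increment vanishes and the formula gives
   [xb 0 = x 0]. *)
have xbE k : xb k = (x k + alpha k.-1 *: (x k - x k.-1))%R.
  case: k => [|k]; first by rewrite /= subrr scaler0 addr0.
  by case: (iter k).
(* [x k.-1] is [x 0] at [k = 0], in accordance with x^{-1} = x^0. *)
pose V k := ((tau k)^-1 * `|x k - xs| ^+ 2 + (sigma k)^-1 * `|y k - ys| ^+ 2
  + xi / T * `|x k - x k.-1| ^+ 2
  + 2 * xi * d2 (K (x k - x k.-1)) (y k - ys))%R.
have V_descent k : (V k.+1 <= xi * V k)%R.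
  have [proxy ybE proxx _] := iter k.
  rewrite -scalerN in proxx.
  have stepx :=
    prox_step hd1 g_proper g_sc (tau_gt0 k) proxx (esym (fineK gxs)) gsub.
  have stepy :=
    prox_step hd2 h_proper h_sc (sigma_gt0 k) proxy (esym (fineK hys)) hsub.
  have dX : (x k.+1 - x k = (x k.+1 - xs) - (x k - xs))%R.
    by rewrite opprB addrA subrK.
  have dY : (y k.+1 - y k = (y k.+1 - ys) - (y k - ys))%R.
    by rewrite opprB addrA subrK.
  rewrite /V /= dX.
  (* The new energy carries the step sizes of index [k.+1], whereas [yb k.+1] uses [beta k] and
     [xb k] uses [alpha k.-1]. *)
  apply: (energy_descent hd2 K_cont xi_gt0 eta1_gt0 eta2_gt0 eta3_gt0 _ _
    eta12 eta13 (mu_ge k.+1 k) (nu_ge k.+1 k.-1)).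
  - by have /andP[? ?] := tauT k; rewrite lef_pV2.
  - by have /andP[? ?] := sigmaS k; rewrite lef_pV2.
  - rewrite -dX -dY -(addrAC (y k.+1)) -ybE; apply: le_trans stepx _.
    by rewrite -opprD dotNl mulrN dotC dotBr -!hKs -dotBr.
  - rewrite -dY; apply: le_trans stepy _.
    have KB : K (xb k - xs)%R = (K (xb k) - K xs)%R by rewrite raddfB.
    by rewrite -(addrAC (x k)) -xbE KB.
have V_le k : (V k <= xi ^+ k * V 0%N)%R.
  elim: k => [|k IH]; first by rewrite mul1r.
  by rewrite (le_trans (V_descent k))// exprS -mulrA ler_pM2l.
have V0E : V 0%N = ((tau 0%N)^-1 * `|xs - x 0%N| ^+ 2
            + (sigma 0%N)^-1 * `|ys - y 0%N| ^+ 2)%R.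
  rewrite /V /= subrr linear0 dot0l normr0 (distrC xs) (distrC ys); ring.
set c := (S^-1 - xi * eta4 * L ^+ 2)%R in eta4_sigma *.
(* The cross term is bounded below by applying the norm bound to [- Dx]. Young's inequality with
   weight [eta4^-1] costs [|Dx|^2 / eta4], absorbed since [T <= eta4], and [eta4 L^2 |Y|^2], which
   after the factor [xi] lowers [S^-1] to [c]. *)
have V_ge k : (T^-1 * `|x k - xs| ^+ 2 + c * `|y k - ys| ^+ 2 <= V k)%R.
  set Dx := (x k - x k.-1)%R; set Y := (y k - ys)%R.
  have := dot_opnorm_le hd2 K_cont (- Dx)%R Y.
  rewrite raddfN /= dotNl normrN -/L => dle.
  have := young_sqr `|Dx|%R (L * `|Y|)%R (etrans (invr_gt0 _) eta4_gt0).
  rewrite invrK exprMn => yg.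
  have /andP[tauk0 taukT] := tauT k; have /andP[sigk0 sigkS] := sigmaS k.
  have mX : (T^-1 * `|x k - xs| ^+ 2 <= (tau k)^-1 * `|x k - xs| ^+ 2)%R.
    by rewrite ler_wpM2r ?sqr_ge0// lef_pV2.
  have mY : (S^-1 * `|Y| ^+ 2 <= (sigma k)^-1 * `|Y| ^+ 2)%R.
    by rewrite ler_wpM2r ?sqr_ge0// lef_pV2.
  have mD : (eta4^-1 * `|Dx| ^+ 2 <= T^-1 * `|Dx| ^+ 2)%R.
    by rewrite ler_wpM2r ?sqr_ge0// lef_pV2.
  have le1 : (0 <= xi * (T^-1 * `|Dx| ^+ 2 + eta4 * (L ^+ 2 * `|Y| ^+ 2)
      + 2 * d2 (K Dx) Y))%R.
    by apply: mulr_ge0 (ltW xi_gt0) _; lra.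
  rewrite /V -/Dx -/Y /c; lra.
have V0_ge0 : (0 <= V 0%N)%R.
  apply: le_trans (V_ge 0%N).
  by rewrite addr_ge0// mulr_ge0 ?sqr_ge0// ltW// invr_gt0.
(* Each distance is isolated by dropping the other nonnegative term of [V_ge]; the positivity of [c]
   is [eta4_sigma]. *)
have x_le k : (`|x k - xs| ^+ 2 <= T * V 0%N * xi ^+ k)%R.
  rewrite -mulrA -ler_pdivrMl// [leRHS]mulrC (le_trans _ (V_le k))//.
  by rewrite (le_trans _ (V_ge k))// lerDl mulr_ge0 ?sqr_ge0// ltW.
have y_le k : (`|y k - ys| ^+ 2 <= c^-1 * V 0%N * xi ^+ k)%R.
  rewrite -mulrA ler_pdivlMl// [leRHS]mulrC (le_trans _ (V_le k))//.
  by rewrite (le_trans _ (V_ge k))// lerDr mulr_ge0 ?sqr_ge0// ltW// invr_gt0.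
have xi1 : (`|xi| < 1)%R by rewrite gtr0_norm.
split=> [k|].
  rewrite -V0E -!EFinM !lee_fin; split.
    by rewrite -mulrA mulrC x_le.
  by rewrite -mulrA mulrC y_le.
split.
- exact: cvg_sqr_geometric xi1 x_le.
- exact: cvg_sqr_geometric xi1 y_le.
- by exists (T * V 0%N + c^-1 * V 0%N)%R => k; rewrite mulrDl lerD.
Qed.
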